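(* Let $F\in\mathcal{O}_{m,L}$ and let $\mathcal{A}\in\mathbb{R}^{n\times n}$, $\mathcal{B}=(\mathcal{B}_1\ \cdots\ \mathcal{B}_s)\in\mathbb{R}^{n\times sc}$, $\mathcal{C}=(\mathcal{C}_1^\top\ \cdots\ \mathcal{C}_s^\top)^\top\in\mathbb{R}^{sc\times n}$ and $\mathcal{D}=(\mathcal{D}_{ij})_{i,j=1}^s\in\mathbb{R}^{sc\times sc}$ be partitioned into blocks ($\mathcal{B}_i\in\mathbb{R}^{n\times c}$, $\mathcal{C}_i\in\mathbb{R}^{c\times n}$, $\mathcal{D}_{ij}\in\mathbb{R}^{c\times c}$), where $\mathcal{D}$ is block-lower-triangular, i.e. $\mathcal{D}_{ij}=0$ for $j>i$. Consider the algorithm $$x_{k+1}=\mathcal{A}x_k+\mathcal{B}w_k,\qquad z_k=\mathcal{C}x_k+\mathcal{D}w_k,\qquad w_k\in F(z_k).$$ If, for every $i\in\{1,\dots,s\}$, the matrix $I-m_i\mathcal{D}_{ii}$ is invertible and $$\mathrm{Sym}\big(-\sigma_i I+\mathcal{D}_{ii}(I-m_i\mathcal{D}_{ii})^{-1}\big)\prec 0\quad\text{with}\quad \sigma_i:=(L_i-m_i)^{-1},$$ then the algorithm is well-posed, i.e. $H:=(F^{-1}-\mathcal{D})^{-1}$ is globally continuous. Moreover, with $H_i:=((\partial f_i)^{-1}-\mathcal{D}_{ii})^{-1}$ for $i\in\{1,\dots,s\}$, the recursion $x_{k+1}=\mathcal{A}x_k+\mathcal{B}H(\mathcal{C}x_k)$,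 $w_k=H(\mathcal{C}x_k)$ admits the following explicit description from any initial condition $x_0\in\mathbb{R}^n$: determine $$w_k^i=H_i\Big(\mathcal{C}_i x_k+\sum_{j=1}^{i-1}\mathcal{D}_{ij}w_k^j\Big)\quad\text{for } i=1,2,\dots,s\text{ in ascending order},$$ and set $x_{k+1}=\mathcal{A}x_k+\sum_{i=1}^s\mathcal{B}_iw_k^i$.
   Context: Function classes. Let $\mathbf{q}(x)=\frac12\|x\|^2$ on $\mathbb{R}^c$. For $m\in\mathbb{R}$ and $L\in(m,\infty]$, $\mathcal{S}_{m,L}$ is the class of functions $f:\mathbb{R}^c\to\mathbb{R}\cup\{\pm\infty\}$ such that $f-m\mathbf{q}$ is proper, convex and closed (p.c.c.) and, if $L<\infty$, also $L\mathbf{q}-f$ is p.c.c. For $f\in\mathcal{S}_{m,L}$ the subdifferential is $\partial f:=\partial(f-m\mathbf{q})+mI$, with the convex subdifferential on the right. Fix $s,c\ge 1$ and vectors $m=(m_1,\dots,m_s)$, $L=(L_1,\dots,L_s)$ with $m_i\in\mathbb{R}$, $L_i\in(m_i,\infty]$ and $\sum_{i=1}^s m_i>0$. $\mathcal{O}_{m,L}$ is the class of operators $F:\mathbb{R}^{sc}\rightrightarrows\mathbb{R}^{sc}$ of the form $F(z)=\partial f_1(z^1)\times\cdots\times\partial f_s(z^s)$, $z=(z^1,\dots,z^s)$, with $f_i\in\mathcal{S}_{m_i,L_i}$, for which there is a unique pair $(\beta^*,w^* )\in\mathbb{R}^c\times\mathbb{R}^{sc}$ with $\sum_{i=1}^s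 w_i^*=0$ and $w_i^*\in\partial f_i(\beta^* )$ for all $i$. Operators. For a set-valued $F$, $F^{-1}(x)=\{y\mid x\in F(y)\}$; a matrix is identified with its linear map. An operator is globally continuous if it is single-valued at every point (exactly one element) and the resulting map is continuous. $\mathrm{Sym}(M)=\frac12(M+M^\top)$; $\sigma_i=0$ if $L_i=\infty$. Signals $w_k,z_k\in\mathbb{R}^{sc}$ are partitioned as $w_k=(w_k^1,\dots,w_k^s)$, $z_k=(z_k^1,\dots,z_k^s)$. *)

(* Defs.v *)
From HB Require Import structures.
From mathcomp Require Import all_boot all_order all_algebra.
From mathcomp Require Import all_classical all_reals all_analysis.
Import Order.TTheory GRing.Theory Num.Theory.
Import numFieldNormedType.Exports.

Set Implicit Arguments.
Unset Strict Implicit.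
Unset Printing Implicit Defensive.

Local Open Scope classical_set_scope.
Local Open Scope ring_scope.

(* R^{sc} is 'cV[R]_(bdim s c), the type that the library's block matrices
   ([submxcol], [submxrow], [submxblock], ...) have for s blocks of size c. *)
Notation bdim s c := (\sum_(i < s) c)%N.

Section Blocks.
Variables (R : realType) (s c : nat).

Definition cblk n (M : 'M[R]_(bdim s c, n)) (i : 'I_s) : 'M[R]_(c, n) :=
  @submxcol R s (fun=> c) n M i.

Definition rblk n (M : 'M[R]_(n, bdim s c)) (j : 'I_s) : 'M[R]_(n, c) :=
  @submxrow R s (fun=> c) n M j.

Definition blk (M : 'M[R]_(bdim s c)) (i j : 'I_s) : 'M[R]_c :=
  @submxblock R s s (fun=> c) (fun=> c) M i j.

End Blocks.

Section ConvexFunctions.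
Variables (R : realType) (c : nat).
Implicit Types (x y v : 'cV[R]_c) (f g : 'cV[R]_c -> \bar R).

Definition dot x y : R := (x^T *m y) 0 0.

(* Half the squared Euclidean norm; the library norm on matrices is the
   sup norm, so it is not used here. *)
Definition qf x : R := 2^-1 * dot x x.

Definition epigraph g : set ('cV[R]_c * R^o)%type :=
  [set p | (g p.1 <= (p.2 : R)%:E)%E].

Definition proper g := (forall x, g x <> -oo%E) /\ (exists x, g x <> +oo%E).

Definition pcc g :=
  [/\ proper g, convex_set (epigraph g) & closed (epigraph g)].

Definition classS (m : R) (L : \bar R) f :=
  pcc (fun x => f x - (m * qf x)%:E)%E /\
  forall l : R, L = l%:E -> pcc (fun x => (l * qf x)%:E - f x)%E.

(* Meant for proper g: it is then empty wherever g takes the value +oo. *)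
Definition convex_subdiff g x : set 'cV[R]_c :=
  [set v | forall y, (g x + (dot v (y - x))%:E <= g y)%E].

Definition subdiff (m : R) f x : set 'cV[R]_c :=
  [set v + m *: x | v in convex_subdiff (fun y => f y - (m * qf y)%:E)%E x].

End ConvexFunctions.

Section OperatorClass.
Variables (R : realType) (s c : nat).

Definition prod_subdiff (m : 'I_s -> R) (f : 'I_s -> 'cV[R]_c -> \bar R)
    (z : 'cV[R]_(bdim s c)) : set 'cV[R]_(bdim s c) :=
  [set w | forall i, subdiff (m i) (f i) (cblk z i) (cblk w i)].

(* F belongs to O_{m,L}, as witnessed by f_1, ..., f_s. *)
Definition classO_with (m : 'I_s -> R) (L : 'I_s -> \bar R)
    (f : 'I_s -> 'cV[R]_c -> \bar R)
    (F : 'cV[R]_(bdim s c) -> set 'cV[R]_(bdim s c)) :=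
  [/\ forall i, classS (m i) (L i) (f i),
      F = prod_subdiff m f &
      exists! bw : 'cV[R]_c * 'cV[R]_(bdim s c),
        \sum_(i < s) cblk bw.2 i = 0 /\
        forall i, subdiff (m i) (f i) bw.1 (cblk bw.2 i)].

End OperatorClass.

Section Operators.
Variables (R : realType) (N : nat).
Implicit Types (F : 'cV[R]_N -> set 'cV[R]_N) (D M : 'M[R]_N).

Definition op_inv F : 'cV[R]_N -> set 'cV[R]_N := fun x => [set y | F y x].

Definition op_subM F D : 'cV[R]_N -> set 'cV[R]_N :=
  fun x => [set u - D *m x | u in F x].

(* (F^{-1} - D)^{-1} *)
Definition loop_op F D := op_inv (op_subM (op_inv F) D).

Definition single_valued F := forall x, exists y, F x = [set y].

Definition globally_continuous F :=
  exists2 h : 'cV[R]_N -> 'cV[R]_N, forall x, F x = [set h x] & continuous h.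

Definition Sym M : 'M[R]_N := 2^-1 *: (M + M^T).

(* Used for symmetric M only. *)
Definition negdef M := forall x : 'cV[R]_N, x != 0 -> dot x (M *m x) < 0.

End Operators.

(* (L - m)^{-1}, read as 0 when L = +oo, for m < L; this is the convention of
   the inverse on \bar R. *)
Definition sigma (R : realType) (m : R) (L : \bar R) : R :=
  fine ((L - m%:E)^-1)%E.

Section Recursions.
Variables (R : realType) (s c n : nat).
Variables (A : 'M[R]_n) (B : 'M[R]_(n, bdim s c)) (C : 'M[R]_(bdim s c, n)).
Implicit Types (x : nat -> 'cV[R]_n) (w : nat -> 'cV[R]_(bdim s c)).

(* An equation y = H(u) for a set-valued H says that y is the only element
   of H(u); it is written H u = [set y]. *)
Definition implicit_recursion (H : 'cV[R]_(bdim s c) -> set 'cV[R]_(bdim s c))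
    (x0 : 'cV[R]_n) x w :=
  x 0%N = x0 /\
  forall k, H (C *m x k) = [set w k] /\ x k.+1 = A *m x k + B *m w k.

Definition explicit_recursion (D : 'M[R]_(bdim s c))
    (Hs : 'I_s -> 'cV[R]_c -> set 'cV[R]_c) (x0 : 'cV[R]_n) x w :=
  x 0%N = x0 /\
  forall k,
    (forall i : 'I_s,
       Hs i (cblk C i *m x k + \sum_(j < s | (j < i)%N) blk D i j *m cblk (w k) j)
       = [set cblk (w k) i]) /\
    x k.+1 = A *m x k + \sum_(i < s) rblk B i *m cblk (w k) i.

End Recursions.

(* Main.v *)
Require Import Defs.
From HB Require Import structures.
From mathcomp Require Import all_boot all_order all_algebra.
From mathcomp Require Import all_classical all_reals all_analysis.
From mathcomp Require Import ring lra.
Import Order.TTheory GRing.Theory Num.Theory.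
Import numFieldNormedType.Exports.

Local Open Scope classical_set_scope.
Local Open Scope ring_scope.

(** Why the theorem is true.

    An element w of (F^{-1} - D)^{-1}(x) is a solution of w \in F(x + D w)
    ([loop_opE]).  As F is a product and D is block-lower-triangular, block i
    of this inclusion contains w^j for j <= i only and says that w^i is in
    H_i(x^i + sum_{j<i} D_ij w^j).  So once every H_i is a continuous function,
    forward substitution produces the unique solution w, continuously in x
    ([forward_substitution]); evaluating it at x = C x_k is the explicit
    description of the algorithm.

    It remains to see that y \in df(x + D y) has exactly one solution y,
    continuous in x, for a single f ([loop_op_continuous]).  Put
    g = f - m qf, V = (I - m D)^{-1} and p = y - m (x + D y).  The substitution
    turns the inclusion into p \in dg(V x + E p) with E = D V, and the
    hypothesis of the theorem says that M = sigma I - E is strongly monotone.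
    The subdifferential dg contributes two facts:
    - it is sigma-cocoercive, sigma |p - p'|^2 <= <p - p', u - u'>
      for p \in dg(u) and p' \in dg(u').  For L = oo this is monotonicity; for
      L < oo it is the Baillon-Haddad theorem ([smooth_cocoercive]);
    - I + mu dg is onto for every mu > 0, because u -> g(u) + |u - z|^2/(2 mu)
      has a minimizer ([prox_exists]).
    Cocoercivity and strong monotonicity together make p a Lipschitz function
    of x, wherever it exists.  For existence the inclusion is rewritten as a
    fixed-point equation of forward-backward type, p = J(lambda p + x - M p)
    with J the inverse of dg^{-1} + (lambda - sigma) I, whose right-hand side is
    a contraction for lambda large ([monotone_feedback]).

    Every existence statement (of an affine minorant of g, a proximal point,
    the least value of a quadratic form on the sphere, a fixed point) is
    obtained by minimizing a continuous function with a bounded sublevel set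
    ([closed_bounded_min]). *)

(** * The Euclidean inner product *)

Section Dot.
Context {R : realType}.

Lemma dotE {c} (x y : 'cV[R]_c) : dot x y = \sum_i x i 0 * y i 0.
Proof. by rewrite /dot !mxE; apply: eq_bigr => i _; rewrite mxE. Qed.

Lemma dotC {c} (x y : 'cV[R]_c) : dot x y = dot y x.
Proof. by rewrite !dotE; apply: eq_bigr => i _; rewrite mulrC. Qed.

Lemma dotDr {c} (x y z : 'cV[R]_c) : dot x (y + z) = dot x y + dot x z.
Proof. by rewrite /dot mulmxDr mxE. Qed.

Lemma dotZr {c} a (x y : 'cV[R]_c) : dot x (a *: y) = a * dot x y.
Proof. by rewrite /dot -scalemxAr mxE. Qed.

Lemma dotNr {c} (x y : 'cV[R]_c) : dot x (- y) = - dot x y.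
Proof. by rewrite /dot mulmxN mxE. Qed.

Lemma dotDl {c} (x y z : 'cV[R]_c) : dot (x + y) z = dot x z + dot y z.
Proof. by rewrite dotC dotDr !(dotC z). Qed.

Lemma dotZl {c} a (x y : 'cV[R]_c) : dot (a *: x) y = a * dot x y.
Proof. by rewrite dotC dotZr (dotC y). Qed.

Lemma dotNl {c} (x y : 'cV[R]_c) : dot (- x) y = - dot x y.
Proof. by rewrite dotC dotNr (dotC y). Qed.

Definition dot_bilinear := (@dotDl, @dotDr, @dotZl, @dotZr, @dotNl, @dotNr).

Lemma dot_ge0 {c} (x : 'cV[R]_c) : 0 <= dot x x.
Proof. by rewrite dotE; apply: sumr_ge0 => i _; rewrite -expr2 sqr_ge0. Qed.

Lemma dot0r {c} (x : 'cV[R]_c) : dot x 0 = 0.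
Proof. by rewrite /dot mulmx0 mxE. Qed.

Lemma dot_eq0 {c} (x : 'cV[R]_c) : (dot x x == 0) = (x == 0).
Proof.
apply/idP/eqP => [|->]; last by rewrite dot0r.
rewrite dotE psumr_eq0 => [/allP x0|i _]; last by rewrite -expr2 sqr_ge0.
apply/matrixP => i j; rewrite ord1 mxE.
by have := x0 i (mem_index_enum _); rewrite /= -expr2 sqrf_eq0 => /eqP.
Qed.

Lemma sqr_coord_le {c} (x : 'cV[R]_c) i : x i 0 ^+ 2 <= dot x x.
Proof.
rewrite dotE (bigD1 i)//= expr2 lerDl; apply: sumr_ge0 => j _.
by rewrite -expr2 sqr_ge0.
Qed.

Lemma dot_young {c} (x y : 'cV[R]_c) t : 0 < t ->
  2 * dot x y <= t * dot x x + t^-1 * dot y y.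
Proof.
move=> t0; have := dot_ge0 (t *: x - y).
rewrite !dot_bilinear (dotC y x) => h.
rewrite -subr_ge0 -(pmulr_rge0 _ t0).
suff -> : t * (t * dot x x + t^-1 * dot y y - 2 * dot x y) =
  t * (t * dot x x) + - (t * dot x y) + - (t * dot x y - dot y y) by lra.
by field; rewrite gt_eqF.
Qed.

(** * Continuity and minimization for the matrix topology *)

Lemma mx_continuous_at {T : topologicalType} {a b} (f : T -> 'M[R]_(a, b)) x :
  (forall i j, f y i j @[y --> x] --> f x i j) -> f y @[y --> x] --> f x.
Proof.
move=> fx; apply/cvg_ballP => e e0; rewrite near_map.
have h ij : \forall y \near x, ball (f x ij.1 ij.2) e (f y ij.1 ij.2).
  exact: (cvg_ball (fx ij.1 ij.2)).
have {}h := filter_forall (nbhs_filter x) h.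
by apply: filterS h => y hy; split => // i j; exact: (hy (i, j)).
Qed.

Lemma continuous_sum {T : topologicalType} {V : normedModType R} {I : finType}
    {P : pred I} (f : I -> T -> V) :
  (forall i, continuous (f i)) -> continuous (fun x => \sum_(i | P i) f i x).
Proof.
move=> fc; apply: continuous_big => // z.
by apply: cvgD; [exact: cvg_fst | exact: cvg_snd].
Qed.

Lemma mulmx_continuous {a b d} (M : 'M[R]_(a, b)) :
  continuous (mulmx M : 'M[R]_(b, d) -> 'M[R]_(a, d)).
Proof.
move=> x; apply: mx_continuous_at => i j.
under eq_fun do rewrite mxE; rewrite mxE.
have := @continuous_sum 'M[R]_(b, d) R 'I_b predT (fun k y => M i k * y k j).
apply => k y.
by rewrite /continuous_at; apply: (cvgM (cvg_cst (M i k)) (@coord_continuous _ _ _ k j y)).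
Qed.

Lemma continuous_dot {T : topologicalType} {c} (f g : T -> 'cV[R]_c) :
  continuous f -> continuous g -> continuous (fun x => dot (f x) (g x)).
Proof.
move=> fc gc; under eq_fun do rewrite dotE.
apply: continuous_sum => k y.
have coordc (h : T -> 'cV[R]_c) : continuous h -> h x k 0 @[x --> y] --> h y k 0.
  move=> hc; apply: (@continuous_comp _ _ _ h (fun M => M k 0) y (hc y)).
  exact: coord_continuous.
exact: (cvgM (coordc f fc) (coordc g gc)).
Qed.

(** The topology comes from the sup norm, whereas the estimates below are
    Euclidean; this lemma is the bridge between the two. *)
Lemma dot_lipschitz_continuous {a b} K (phi : 'cV[R]_a -> 'cV[R]_b) :
  (forall x y, dot (phi x - phi y) (phi x - phi y) <= K * dot (x - y) (x - y)) ->
  continuous phi.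
Proof.
move=> phiK x; apply: mx_continuous_at => i j; rewrite ord1; have FF := nbhs_filter x.
apply/cvgrPdist_lt => e e0.
have h : K * dot (x - y) (x - y) @[y --> x] --> K * dot (x - x) (x - x).
  suff dc : continuous (fun y : 'cV[R]_a => dot (x - y) (x - y)).
    exact: (cvgM (cvg_cst K) (dc x)).
  suff xc : continuous (fun y : 'cV[R]_a => x - y) by exact: continuous_dot.
  move=> y; have FFy := nbhs_filter y.
  by apply: cvgB; [exact: cvg_cst | exact: cvg_id].
have {}h : \forall y \near x, K * dot (x - y) (x - y) < e ^+ 2.
  apply: (cvgr_lt _ h); rewrite subrr dot0r mulr0.
  by rewrite exprn_gt0.
near=> y; rewrite -(ltr_pXn2r (n := 2))// ?nnegrE ?ltW// real_normK ?num_real//.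
apply: le_lt_trans (_ : K * dot (x - y) (x - y) < _); last by near: y.
apply: le_trans (phiK x y).
by have := sqr_coord_le (phi x - phi y) i; rewrite !mxE.
Unshelve. all: by end_near. Qed.

(** The sublevel set of x0 in E is compact, so the extreme value theorem
    applies to it.  The extra real coordinate makes room for epigraphs. *)
Lemma closed_bounded_min {c} (E : set ('cV[R]_c * R^o)%type)
    (psi : 'cV[R]_c * R^o -> R) (x0 : 'cV[R]_c * R^o) (K l r : R) :
  closed E -> continuous psi -> E x0 ->
  (forall x, E x -> psi x <= psi x0 -> dot x.1 x.1 <= K /\ l <= x.2 <= r) ->
  exists2 x, E x & forall y, E y -> psi x <= psi y.
Proof.
move=> clE psic Ex0 bnd.
pose S := E `&` [set x | psi x <= psi x0].
have clS : closed S.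
  apply: closedI => //.
  apply: (@closed_comp _ _ psi [set t | t <= psi x0]); first by move=> ? _; exact: psic.
  exact: closed_le.
(* Boxes of column vectors are compact as transposes of boxes of rows. *)
have cV : compact [set v : 'cV[R]_c | forall i, v i 0 \in `[- (K + 1), K + 1]].
  pose box := [set v : 'rV[R]_c | forall i, v 0 i \in `[- (K + 1), K + 1]].
  have : compact box.
    apply: (@rV_compact _  _ (fun=> `[(- (K + 1)), (K + 1)]%classic)).
    by move=> _; apply: segment_compact.
  move=> cV; have {cV} : compact (trmx @` box).
    apply: continuous_compact cV; apply: continuous_subspaceT => x.
    apply: mx_continuous_at => i j.
    by rewrite mxE; under eq_fun do rewrite mxE; exact: coord_continuous.
  congr compact; apply/seteqP; split=> [_ [v hv <-] i|v hv]; first by rewrite mxE.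
  by exists v^T; [move=> i; rewrite mxE | rewrite trmxK].
have cS : compact S.
  apply: subclosed_compact clS (compact_setX cV (segment_compact (a := l) (b := r))) _.
  move=> x [Ex px]; have [h1 h2] := bnd x Ex px; split; rewrite /= ?in_itv//=.
  (* The bound K + 1 serves because K <= (K + 1)^2. *)
  move=> i; rewrite in_itv/= -ler_norml.
  have := le_trans (sqr_coord_le x.1 i) h1 => h.
  have K0 : 0 <= K := le_trans (dot_ge0 _) h1.
  rewrite -(ler_pXn2r (n := 2)) ?nnegrE ?addr_ge0// real_normK ?num_real//.
  nra.
have [|x xS xmin] := compact_EVT_min (ex_intro _ x0 (conj Ex0 (lexx _))) cS (f := psi).
  exact: continuous_subspaceT.
move/set_mem: xS => [Ex px]; exists x => // y Ey.
have [yx0|/ltW yx0] := leP (psi y) (psi x0); last exact: le_trans yx0.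
by apply: xmin; apply/mem_set.
Qed.

End Dot.

(** * Subgradients and proximal points of closed convex functions *)

Section Convex.
Context {R : realType} {c : nat}.
Implicit Types (g : 'cV[R]_c -> \bar R).

(** First-order conditions at a minimizer are read off along segments: dividing
    the increment by the step t leaves an error proportional to t. *)
Lemma le_of_le_add_small (a b d : R) :
  (forall t, 0 < t -> t <= 1 -> a <= b + t * d) -> a <= b.
Proof.
move=> h; apply/ler_addgt0Pr => e e0.
have d1 : 0 < `|d| + 1 by rewrite ltr_wpDl.
pose t := Num.min 1 (e / (`|d| + 1)).
have t0 : 0 < t by rewrite lt_min ltr01 divr_gt0.
have t1 : t <= 1 by rewrite ge_min lexx.
have te : t * (`|d| + 1) <= e by rewrite -ler_pdivlMr// ge_min lexx orbT.
have := h t t0 t1; have := ler_norm d; nra.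
Qed.

Lemma epigraph_conv {g u v} {r s t : R} : convex_set (epigraph g) ->
  0 <= t -> t <= 1 -> (g u <= r%:E)%E -> (g v <= s%:E)%E ->
  (g (u + t *: (v - u))%R <= (r + t * (s - r))%:E)%E.
Proof.
move=> cg t0 t1 gu gv.
have := cg (v, s) (u, r) (Itv01 t0 t1) (mem_set gv) (mem_set gu).
move/set_mem; rewrite /epigraph /= /conv /=.
have -> : t *: v + (1 - t) *: u = u + t *: (v - u).
  by rewrite scalerBl scale1r scalerBr addrC -addrA; congr (_ + _); rewrite addrC.
suff -> : t * s + (1 - t) * r = r + t * (s - r) by [].
by ring.
Qed.

(** A proper function is finite wherever it has a subgradient, so subgradient
    inequalities can be handled in R, on the points of the epigraph. *)
Lemma convex_subdiffP {g} u p : Defs.proper g ->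
  convex_subdiff g u p <->
  exists2 r, g u = r%:E &
    forall y t, (g y <= t%:E)%E -> r + dot p (y - u) <= t.
Proof.
move=> [gNy [x gx]]; split=> [gup|[r gu gup] y]; last first.
  rewrite gu -EFinD; case gy : (g y) => [t| |]; last by case: (gNy y).
    by rewrite lee_fin; apply: gup; rewrite gy.
  by rewrite leey.
case gu : (g u) => [r| |]; last by case: (gNy u).
  exists r => // y t gyt; rewrite -lee_fin; apply: le_trans gyt.
  by rewrite EFinD -gu; exact: gup.
have := gup x; rewrite gu addye// leye_eq => /eqP h; by case: gx.
Qed.

Lemma continuous_sqdist (x : 'cV[R]_c) :
  continuous (fun p : 'cV[R]_c * R^o => dot (p.1 - x) (p.1 - x)).
Proof.
suff xc : continuous (fun p : 'cV[R]_c * R^o => p.1 - x) by exact: continuous_dot.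
move=> p; have FFp := nbhs_filter p.
by apply: cvgB; [exact: cvg_fst | exact: cvg_cst].
Qed.

Lemma dot_line (x y : 'cV[R]_c) t :
  dot (x + t *: y) (x + t *: y) = dot x x + t * (2 * dot x y) + t ^+ 2 * dot y y.
Proof. by rewrite !dot_bilinear (dotC y x); ring. Qed.

(** Separation of the epigraph from the point (x, g x - 1) just below it: the
    segment to the projection (u, t) of that point on the epigraph is the
    normal of a supporting hyperplane, and the hyperplane is not vertical. *)
Lemma affine_minorant {g} : pcc g ->
  exists a b, forall u t, (g u <= t%:E)%E -> dot a u + b <= t.
Proof.
move=> [[gNy [x gx]] cg clg].
have [r gxr] : exists r, g x = r%:E.
  by case gE : (g x) => [r| |]; [exists r | case: gx | case: (gNy x)].
pose psi (p : 'cV[R]_c * R^o) := dot (p.1 - x) (p.1 - x) + (p.2 - (r - 1)) ^+ 2.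
have [|||[u t] /= gut umin] := @closed_bounded_min R c (epigraph g) psi (x, r)
    (2 + 2 * dot x x) (r - 2) r clg.
- move=> p; have FFp := nbhs_filter p.
  apply: cvgD; first exact: continuous_sqdist.
  apply: (@continuous_comp _ _ _ (fun p : 'cV[R]_c * R^o => p.2 - (r - 1)) (fun z => z ^+ 2)).
    by apply: cvgB; [exact: cvg_snd | exact: cvg_cst].
  exact: exprn_continuous.
- by rewrite /epigraph /= gxr.
- move=> [v s] /= _; rewrite /psi /= subrr.
  rewrite dot0r.
  have h1 := dot_ge0 (v - x); have h2 := dot_ge0 (v - x - x).
  rewrite !dot_bilinear (dotC x v) in h1 h2 *.
  have h3 := sqr_ge0 (s - (r - 1)) => h4.
  by split; [lra | apply/andP; split; nra].
have first_order v s : (g v <= s%:E)%E ->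
    0 <= dot (u - x) (v - u) + (t - (r - 1)) * (s - t).
  move=> gvs; suff : 0 <= 2 * (dot (u - x) (v - u) + (t - (r - 1)) * (s - t)) by lra.
  apply: (@le_of_le_add_small _ _ (dot (v - u) (v - u) + (s - t) ^+ 2)) => tau tau0 tau1.
  have := umin (u + tau *: (v - u), t + tau * (s - t)) (epigraph_conv cg (ltW tau0) tau1 gut gvs).
  rewrite /psi /= (_ : u + tau *: (v - u) - x = (u - x) + tau *: (v - u)); last first.
    by rewrite addrAC.
  rewrite dot_line => h.
  rewrite -(pmulr_rge0 _ tau0); nra.
(* The normal is (u - x, t - (r - 1)); its last entry is not 0, since
   otherwise (x, r - 1) would be its own projection and lie on the epigraph. *)
have b_ge0 : 0 <= t - (r - 1).
  have := first_order u (t + 1).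
  rewrite subrr dot0r => /(_ _)/le_trans; apply; last by lra.
  by apply: le_trans gut _; rewrite lee_fin lerDl.
have b_gt0 : 0 < t - (r - 1).
  rewrite lt_neqAle b_ge0 andbT; apply/eqP => b0.
  have := first_order x r; rewrite gxr lexx => /(_ isT).
  rewrite -b0 mul0r addr0 -[x - u]opprB dotNr oppr_ge0 => ux.
  have /eqP := le_anti (introT andP (conj ux (dot_ge0 _))).
  rewrite dot_eq0 subr_eq0 => /eqP ux0.
  by move: gut; rewrite /epigraph/= ux0 gxr lee_fin; lra.
exists (- (t - (r - 1))^-1 *: (u - x)), (t + (t - (r - 1))^-1 * dot (u - x) u).
move=> v s /first_order; rewrite dotZl dotDr dotNr => h.
rewrite -(ler_pM2l b_gt0).
rewrite (_ : _ * (_ + _) = (t - (r - 1)) * t - dot (u - x) v + dot (u - x) u); last first.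
  by field; rewrite gt_eqF.
lra.
Qed.

(** The affine minorant makes g(u) + |u - z|^2/(2 mu) coercive; a minimizer u
    satisfies (z - u)/mu \in dg(u).  Here the function is multiplied by 2 mu and
    minimized over the epigraph, where it is continuous. *)
Lemma prox_exists {g} (mu : R) z : pcc g -> 0 < mu ->
  exists u p, convex_subdiff g u p /\ z = u + mu *: p.
Proof.
move=> pg mu0; have [a [b gab]] := affine_minorant pg.
have [[gNy [x gx]] cg clg] := pg.
have [r gxr] : exists r, g x = r%:E.
  by case gE : (g x) => [r| |]; [exists r | case: gx | case: (gNy x)].
pose psi (p : 'cV[R]_c * R^o) := dot (p.1 - z) (p.1 - z) + 2 * mu * p.2.
pose K := 2 * (psi (x, r) - 2 * mu * b - dot z z + 2 * dot (z - mu *: a) (z - mu *: a)).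
have [|||[u t] /= gut umin] := @closed_bounded_min R c (epigraph g) psi (x, r)
    K (b - (dot a a + K) / 2) (psi (x, r) / (2 * mu)) clg.
- move=> p; have FFp := nbhs_filter p.
  apply: cvgD; first exact: continuous_sqdist.
  by apply: cvgM; [exact: cvg_cst | exact: cvg_snd].
- by rewrite /epigraph /= gxr.
- move=> [v s] /= /gab /= vs; rewrite {1}/psi /= => h.
  have vz := dot_ge0 (v - z).
  (* Completing the square: the cross term <v, z - mu a> costs half of |v|^2. *)
  have vK : dot v v <= K.
    have half_gt0 : 0 < 2^-1 :> R by rewrite invr_gt0 ltr0n.
    have := dot_young v (z - mu *: a) 2^-1 half_gt0; rewrite invrK /K.
    set W := dot (z - _) _; rewrite dotDr dotNr dotZr (dotC v a) => yW.
    have vs' : 2 * mu * (dot a v + b) <= 2 * mu * s.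
      by rewrite ler_pM2l//; lra.
    move: h; rewrite !dot_bilinear (dotC z v); set P := psi _; lra.
  split=> //; apply/andP; split.
    by have := dot_young (- a) v 1 ltr01; rewrite invr1 !dot_bilinear; lra.
  rewrite ler_pdivlMr; last by lra.
  lra.
exists u, (mu^-1 *: (z - u)); split; last first.
  by rewrite scalerA divff ?gt_eqF// scale1r addrC subrK.
apply/convex_subdiffP; first by case: pg.
(* A minimizer lies on the graph, since lowering t lowers psi. *)
have gu_t : g u = t%:E.
  move: gut; rewrite /epigraph /=; case gu : (g u) => [t'| |]; last by case: (gNy u).
  - rewrite lee_fin => t't; congr EFin; apply: le_anti; rewrite t't/=.
    have := umin (u, t'); rewrite /epigraph/psi/= gu => /(_ (lexx _)).
    by rewrite lerD2l ler_pM2l//; lra.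
  - by rewrite leye_eq.
exists t => // v s gvs.
suff : mu * (t - s) <= dot (u - z) (v - u).
  move=> h; rewrite dotZl -[z - u]opprB dotNl -(ler_pM2l mu0) mulrDr mulVKf ?gt_eqF//.
  lra.
suff : 2 * mu * (t - s) <= 2 * dot (u - z) (v - u) by lra.
apply: (@le_of_le_add_small _ _ (dot (v - u) (v - u))) => tau tau0 tau1.
have := umin (u + tau *: (v - u), t + tau * (s - t)) (epigraph_conv cg (ltW tau0) tau1 gut gvs).
rewrite /psi /= (_ : u + tau *: (v - u) - z = (u - z) + tau *: (v - u)); last first.
  by rewrite addrAC.
rewrite dot_line => h.
rewrite -(ler_pM2l tau0); nra.
Qed.

(** The Baillon-Haddad theorem.  Convexity of l qf - G gives the quadratic upper
    bound G(w + d) <= G w + <r, d> + l/2 |d|^2 at a subgradient r; comparing it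
    with the subgradient inequality of another point w', at the best step
    d = (r' - r)/l, improves that inequality by |r' - r|^2/(2 l).  The two
    improved inequalities add up to the claim. *)
Lemma smooth_cocoercive (G : 'cV[R]_c -> R) (l : R) u v p q :
  0 < l ->
  (forall x y t, 0 <= t -> t <= 1 ->
     l * qf (x + t *: (y - x)) - G (x + t *: (y - x)) <=
      l * qf x - G x + t * (l * qf y - G y - (l * qf x - G x))) ->
  (forall y, G u + dot p (y - u) <= G y) ->
  (forall y, G v + dot q (y - v) <= G y) ->
  dot (p - q) (p - q) <= l * dot (p - q) (u - v).
Proof.
move=> l0 kc pu qv.
have descent w r : (forall y, G w + dot r (y - w) <= G y) ->
    forall d, G (w + d) <= G w + dot r d + l / 2 * dot d d.
  move=> rw d.
  suff : G (w + d) - G w - dot r d - l / 2 * dot d d <= 0 by lra.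
  apply: (@le_of_le_add_small _ _ (l / 2 * dot d d)) => t t0 t1.
  have s0 : 0 < 1 + t by rewrite addr_gt0.
  (* w divides the segment from w - t d to w + d in the ratio tau. *)
  pose tau := t / (1 + t).
  have tauE : tau * (1 + t) = t by rewrite /tau divfK// gt_eqF.
  have tau0 : 0 <= tau by rewrite divr_ge0// ltW.
  have tau1 : tau <= 1 by rewrite ler_pdivrMr//; lra.
  have wE : w - t *: d + tau *: (w + d - (w - t *: d)) = w.
    apply/matrixP => i j; rewrite !mxE.
    by have := congr1 ( *%R^~ (d i j)) tauE; lra.
  have := kc (w - t *: d) (w + d) tau tau0 tau1; rewrite wE.
  have := rw (w - t *: d).
  rewrite /qf (_ : w - t *: d - w = - t *: d); last by rewrite addrAC subrr add0r scaleNr.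
  rewrite !dot_bilinear (dotC d w) => h1.
  rewrite -(ler_pM2l s0) [X in _ <= X]mulrDr (mulrA (1 + t) tau) (mulrC (1 + t) tau) tauE => h2.
  by rewrite -(ler_pM2l t0); lra.
have gap w r w' r' : (forall y, G w + dot r (y - w) <= G y) ->
    (forall y, G w' + dot r' (y - w') <= G y) ->
    l * (G w' + dot r' (w - w')) + dot (r' - r) (r' - r) / 2 <= l * G w.
  move=> rw rw'; have [e le] : exists e, r' - r = l *: e.
    by exists (l^-1 *: (r' - r)); rewrite scalerA divff ?gt_eqF// scale1r.
  have re : dot r' e - dot r e = l * dot e e.
    by rewrite -dotNl -dotDl le dotZl.
  have := le_trans (rw' _) (descent _ _ rw e).
  rewrite (addrAC w e) (dotDr _ (w - w')) le dotZl dotZr => h.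
  have {}h : G w' + dot r' (w - w') + l * dot e e / 2 <= G w by lra.
  by move: h; rewrite -(ler_pM2l l0); lra.
have := gap _ _ _ _ pu qv; have := gap _ _ _ _ qv pu.
rewrite -[q - p]opprB -[v - u]opprB !dotNl !dotNr.
rewrite (dotDl p (- q) (u - v)) (dotNl q (u - v)) opprK; lra.
Qed.

End Convex.

(** * Cocoercive relations in feedback with a strongly monotone matrix *)

Section ForwardBackward.
Context {R : realType} {c : nat}.

Lemma closed_bounded_min_vec (E : set 'cV[R]_c) (psi : 'cV[R]_c -> R) x0 (K : R) :
  closed E -> continuous psi -> E x0 ->
  (forall x, E x -> psi x <= psi x0 -> dot x x <= K) ->
  exists2 x, E x & forall y, E y -> psi x <= psi y.
Proof.
move=> clE psic Ex0 bnd.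
pose E' := [set p : 'cV[R]_c * R^o | E p.1 /\ p.2 = 0].
have clE' : closed E'.
  apply: closedI.
    by apply: (@closed_comp _ _ fst E) => // p _; exact: cvg_fst.
  apply: (@closed_comp _ _ (snd : 'cV[R]_c * R^o -> R^o) [set 0]).
    by move=> p _; exact: cvg_snd.
  exact: closed_eq.
have psic' : continuous (fun p : 'cV[R]_c * R^o => psi p.1).
  move=> p; apply: (@continuous_comp _ _ _ fst psi p); last exact: psic.
  exact: cvg_fst.
have [||[x t] /= [Ex _] xmin] := @closed_bounded_min R c E' _ (x0, 0) K 0 0 clE' psic'.
- by [].
- by move=> [y s] [/= Ey /= ->] le; rewrite lexx; split=> //; exact: bnd.
by exists x => // y Ey; exact: (xmin (y, 0)).
Qed.

(** k is the least value of the form on the unit sphere (any number in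
    dimension 0).  The bound serves twice: with k > 0 for positive definite
    forms, and with Q = - M^T M to bound |M x|. *)
Lemma quadratic_lower_bound (Q : 'M[R]_c) :
  exists k, (forall x, k * dot x x <= dot x (Q *m x)) /\
    ((forall x, x != 0 -> 0 < dot x (Q *m x)) -> 0 < k).
Proof.
have [[x0 x0N0]|all0] := pselect (exists x : 'cV[R]_c, x != 0); last first.
  exists 1; split=> // x; suff -> : x = 0 by rewrite mulmx0 !dot0r mulr0.
  by apply/eqP; apply: contrapT => /negP xN0; apply: all0; exists x.
have unit (x : 'cV[R]_c) : x != 0 -> exists2 a, a != 0 & dot (a *: x) (a *: x) = 1.
  move=> xN0; have x2 : 0 < dot x x by rewrite lt_neqAle eq_sym dot_eq0 xN0 dot_ge0.
  exists (Num.sqrt (dot x x))^-1; first by rewrite invr_eq0 gt_eqF// sqrtr_gt0.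
  rewrite dotZl dotZr mulrA -expr2 exprVn sqr_sqrtr ?ltW// mulVf// gt_eqF//.
have [a a0 ax0] := unit _ x0N0.
have dc : continuous (fun x : 'cV[R]_c => dot x x).
  by apply: continuous_dot => x; exact: cvg_id.
have [||||u u1 umin] := @closed_bounded_min_vec [set x | dot x x = 1]
    (fun x => dot x (Q *m x)) (a *: x0) 1.
- apply: (@closed_comp _ _ (fun x : 'cV[R]_c => dot x x) [set 1]).
    by move=> x _; exact: dc.
  exact: closed_eq.
- by apply: continuous_dot => x; [exact: cvg_id | exact: mulmx_continuous].
- exact: ax0.
- by move=> x /= ->.
exists (dot u (Q *m u)); split=> [x|Qpos]; last first.
  apply: Qpos; apply/eqP => u0; move: u1; rewrite /= u0 dot0r.
  by move=> /esym/eqP; rewrite oner_eq0.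
have [->|xN0] := eqVneq x 0; first by rewrite mulmx0 !dot0r mulr0.
have [b b0 bx] := unit _ xN0.
have := umin _ bx; rewrite -scalemxAr dotZl dotZr.
move: bx; rewrite dotZl dotZr => bx h.
have b2 : 0 < b * b by rewrite -expr2 exprn_even_gt0.
by rewrite -(ler_pM2l b2); have := congr1 ( *%R (dot u (Q *m u))) bx; lra.
Qed.

Lemma dot_sq_le (a b : 'cV[R]_c) (e : R) : 0 <= e ->
  e * dot a a <= dot a b -> e ^+ 2 * dot a a <= dot b b.
Proof.
move=> e0 h; have := dot_ge0 (b + (- e) *: a); rewrite dot_line (dotC b a).
by have := ler_wpM2l e0 h; lra.
Qed.

(** A minimizer x of |x - phi x| is a fixed point, since phi x would do better
    by the factor 1 - d.  Minimization is used because the contraction is one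
    for the Euclidean norm only. *)
Lemma contraction_fixed_point (phi : 'cV[R]_c -> 'cV[R]_c) (d : R) : 0 < d ->
  (forall x y, dot (phi x - phi y) (phi x - phi y) <= (1 - d) * dot (x - y) (x - y)) ->
  exists x, phi x = x.
Proof.
move=> d0 ctr.
have phic : continuous phi := dot_lipschitz_continuous _ _ ctr.
pose psi (p : 'cV[R]_c) := dot (p - phi p) (p - phi p).
have [||||x _ xmin] := @closed_bounded_min_vec setT psi 0
   ((1 + d^-1) * (4 * dot (phi 0) (phi 0)) / d ^+ 2).
- exact: closedT.
- have pc : continuous (fun p : 'cV[R]_c => p - phi p); last exact: continuous_dot.
  by move=> p; have FFp := nbhs_filter p; apply: cvgB; [exact: cvg_id | exact: phic].
- by [].
- move=> x _; rewrite /psi sub0r dotNl dotNr opprK => xle.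
  (* Coercivity: x = a + b with a bounded on the sublevel set and
     |b|^2 <= (1 - d) |x|^2; weighting the cross term 2 <a, b> by d leaves
     d^2 |x|^2 <= (1 + 1/d) |a|^2. *)
  have := ctr x 0; rewrite subr0.
  pose a := x - phi x + phi 0; pose b := phi x - phi 0.
  have xE : x = a + b by rewrite /a /b (addrC (phi x)) addrA addrK subrK.
  have a2 : dot a a <= 4 * dot (phi 0) (phi 0).
    have := dot_ge0 (x - phi x - phi 0).
    by rewrite /a; move: (x - phi x) xle => r; rewrite !dot_bilinear (dotC (phi 0) r); lra.
  have := dot_young a b _ (_ : 0 < d^-1); rewrite invr_gt0 => /(_ d0).
  rewrite invrK => ab.
  have x2 : dot x x = dot a a + 2 * dot a b + dot b b.
    by rewrite xE; move: a b {a2 ab xE} => a b; rewrite !dot_bilinear (dotC b a); ring.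
  rewrite -/b => bx.
  rewrite ler_pdivlMr ?exprn_gt0//.
  have h1 : (1 + d^-1) * dot a a <= (1 + d^-1) * (4 * dot (phi 0) (phi 0)).
    by rewrite ler_wpM2l// addr_ge0// invr_ge0 ltW.
  apply: le_trans h1.
  have d1 : 0 <= 1 + d by lra.
  have := ler_wpM2l d1 bx; nra.
exists x; apply/eqP; rewrite eq_sym -subr_eq0 -dot_eq0 eq_le dot_ge0 andbT.
have := xmin (phi x) I; have := ctr x (phi x); rewrite /psi -/(psi x) => h1 h2.
by rewrite -(pmulr_rle0 _ d0); move: (le_trans h2 h1); rewrite /psi; lra.
Qed.

(** S u p stands for p \in T u; the second hypothesis on S is surjectivity of
    I + mu T.  With z = u + (lam - sig) p, cocoercivity says that p is a
    1/lam-Lipschitz function J of z, and the inclusion becomes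
    p = J(lam p + x - M p).  The forward step satisfies
    |lam d - M d|^2 <= (lam^2 - 2 lam eps + |M|^2) |d|^2, which makes the
    composite a contraction as soon as |M|^2 <= lam eps. *)
Lemma monotone_feedback (S : 'cV[R]_c -> 'cV[R]_c -> Prop) (sig eps : R)
    (M : 'M[R]_c) :
  0 <= sig -> 0 < eps ->
  (forall u p v q, S u p -> S v q ->
     sig * dot (p - q) (p - q) <= dot (p - q) (u - v)) ->
  (forall mu z, 0 < mu -> exists u p, S u p /\ z = u + mu *: p) ->
  (forall x, eps * dot x x <= dot x (M *m x)) ->
  exists2 h : 'cV[R]_c -> 'cV[R]_c, continuous h &
    forall x p, S (x + sig *: p - M *m p) p <-> p = h x.
Proof.
move=> sig0 eps0 Smon Sres Mpos.
(* - k bounds the square of the operator norm of M. *)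
have [k [kM _]] := quadratic_lower_bound (- (M^T *m M)).
have {}kM x : dot (M *m x) (M *m x) <= - k * dot x x.
  have := kM x; rewrite mulNmx dotNr.
  suff -> : dot x (M^T *m M *m x) = dot (M *m x) (M *m x) by lra.
  by rewrite /dot trmx_mul !mulmxA.
pose lam := sig + 1 + `|k| / eps.
have lam_sig : 0 < lam - sig.
  suff : 0 <= `|k| / eps by rewrite /lam; lra.
  by rewrite divr_ge0// ltW.
have lam0 : 0 < lam by lra.
have klam : - k <= lam * eps.
  rewrite /lam mulrDl divfK ?gt_eqF//.
  have := ler_norm (- k); rewrite normrN; have := mulr_ge0 sig0 (ltW eps0); lra.
have /choice[J JP] z : exists p, exists2 u, S u p & z = u + (lam - sig) *: p.
  by have [u [p [Sup ->]]] := Sres (lam - sig) z lam_sig; exists p, u.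
have Jlip y z : lam ^+ 2 * dot (J y - J z) (J y - J z) <= dot (y - z) (y - z).
  apply: dot_sq_le; first exact: ltW.
  have [u Su yE] := JP y; have [v Sv zE] := JP z.
  have := Smon _ _ _ _ Su Sv.
  have -> : y - z = (u - v) + (lam - sig) *: (J y - J z).
    by rewrite {1}yE {1}zE scalerBr opprD addrACA.
  by rewrite (dotDr _ (u - v)) dotZr; lra.
(* Uniqueness and Lipschitz dependence on x in a single estimate. *)
have uniq x y p q : S (x + sig *: p - M *m p) p -> S (y + sig *: q - M *m q) q ->
    eps ^+ 2 * dot (p - q) (p - q) <= dot (x - y) (x - y).
  move=> Sp Sq; apply: dot_sq_le; first exact: ltW.
  have := Smon _ _ _ _ Sp Sq; have := Mpos (p - q).
  have -> : x + sig *: p - M *m p - (y + sig *: q - M *m q) =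
    (x - y) + sig *: (p - q) - M *m (p - q).
    by rewrite mulmxBr; apply/matrixP => i j; rewrite !mxE; ring.
  by rewrite (dotDr _ (x - y + _)) (dotDr _ (x - y)) dotZr dotNr; lra.
have /choice[h hP] x : exists p, S (x + sig *: p - M *m p) p.
  pose phi p := J (lam *: p + x - M *m p).
  have [||p pE] := @contraction_fixed_point phi (eps / lam).
  - by rewrite divr_gt0.
  - move=> p q; rewrite -(ler_pM2l (exprn_gt0 2 lam0)).
    apply: le_trans (Jlip _ _) _.
    have -> : lam *: p + x - M *m p - (lam *: q + x - M *m q) =
       lam *: (p - q) - M *m (p - q).
      by rewrite mulmxBr; apply/matrixP => i j; rewrite !mxE; ring.
    have -> : lam ^+ 2 * ((1 - eps / lam) * dot (p - q) (p - q)) =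
      lam ^+ 2 * dot (p - q) (p - q) - lam * eps * dot (p - q) (p - q).
      by field; rewrite gt_eqF.
    move: (p - q) => d; rewrite !dot_bilinear (dotC (M *m d) d).
    have := kM d; have := ler_wpM2l (ltW lam0) (Mpos d).
    have := ler_wpM2r (dot_ge0 d) klam; lra.
  exists p; have [u] := JP (lam *: p + x - M *m p); rewrite -/(phi p) pE => Su uE.
  suff -> : x + sig *: p - M *m p = u by [].
  apply: (addIr ((lam - sig) *: p)); rewrite -uE scalerBl.
  by apply/matrixP => i j; rewrite !mxE; ring.
exists h.
  apply: (@dot_lipschitz_continuous _ _ _ (eps ^- 2)) => x y.
  by rewrite ler_pdivlMl ?exprn_gt0//; exact: uniq.
move=> x p; split=> [Sp|->]; last exact: hP.
apply/eqP; rewrite -subr_eq0 -dot_eq0 eq_le dot_ge0 andbT.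
have := uniq _ _ _ _ Sp (hP x).
by rewrite subrr dot0r pmulr_rle0 ?exprn_gt0.
Qed.

End ForwardBackward.

(** * The loop operator of a single function *)

Lemma loop_opE {R : realType} {N} (F : 'cV[R]_N -> set 'cV[R]_N) (D : 'M[R]_N) x y :
  loop_op F D x y <-> F (x + D *m y) y.
Proof.
split=> [[u Fuy <-]|Fy]; first by rewrite subrK.
by exists (x + D *m y) => //; rewrite addrK.
Qed.

Section Block.
Context {R : realType} {c : nat}.

Lemma convex_subdiff_monotone {g : 'cV[R]_c -> \bar R} {u v p q} : Defs.proper g ->
  convex_subdiff g u p -> convex_subdiff g v q -> 0 <= dot (p - q) (u - v).
Proof.
move=> pg /(convex_subdiffP _ _ pg)[r gu pu] /(convex_subdiffP _ _ pg)[s gv qv].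
have := pu v s; rewrite gv lexx => /(_ isT).
have := qv u r; rewrite gu lexx => /(_ isT).
by rewrite -[v - u]opprB dotNr (dotDl p) dotNl; lra.
Qed.

(** For L < oo the function g is finite everywhere, because L qf - f never takes
    the value -oo, and (L - m) qf - g = L qf - f is convex. *)
Lemma classS_cocoercive {m : R} {L : \bar R} {f : 'cV[R]_c -> \bar R} {u v p q} :
  let g := fun x => (f x - (m * qf x)%:E)%E in
  classS m L f -> (m%:E < L)%E ->
  convex_subdiff g u p -> convex_subdiff g v q ->
  sigma m L * dot (p - q) (p - q) <= dot (p - q) (u - v).
Proof.
move=> g [[pg _ _] fL] mL up vq.
case: L mL fL => [l| |//]; last first.
  move=> _ _; rewrite /sigma addye// invey/= mul0r.
  exact: convex_subdiff_monotone up vq.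
rewrite lte_fin => ml /(_ l erefl)[[kNy _] ck _].
have lm0 : 0 < l - m by rewrite subr_gt0.
have fin x : f x \is a fin_num.
  rewrite fin_numE; apply/andP; split; apply/eqP => fx.
    by case: pg => /(_ x) + _; apply; rewrite /g fx.
  by apply: (kNy x); rewrite fx.
pose G x := fine (f x) - m * qf x.
have gE x : g x = (G x)%:E by rewrite /g -(fineK (fin x)).
have kE x : ((l * qf x)%:E - f x)%E = ((l - m) * qf x - G x)%:E.
  by rewrite -(fineK (fin x)) -EFinB; congr EFin; rewrite /G; ring.
have sub w r : convex_subdiff g w r -> forall y, G w + dot r (y - w) <= G y.
  by move=> wr y; have := wr y; rewrite !gE -EFinD lee_fin.
rewrite /sigma -EFinB inver gt_eqF//= ler_pdivrMl//.
apply: (@smooth_cocoercive R c G) => // [x y t t0 t1||]; [|exact: sub|exact: sub].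
have := @epigraph_conv R c _ x y ((l - m) * qf x - G x) ((l - m) * qf y - G y) t ck t0 t1.
by rewrite !kE !lee_fin; apply.
Qed.

Lemma dot_Sym (M : 'M[R]_c) x : dot x (Sym M *m x) = dot x (M *m x).
Proof.
rewrite /Sym -scalemxAl dotZr mulmxDl dotDr.
suff -> : dot x (M^T *m x) = dot x (M *m x) by field.
by rewrite [RHS]dotC /dot trmx_mul mulmxA.
Qed.

(** The loop shift p = y - m (x + D y) replaces f by the convex g = f - m qf and D
    by D (I - m D)^{-1}, to which [monotone_feedback] applies. *)
Lemma loop_op_continuous {m : R} {L : \bar R} {f : 'cV[R]_c -> \bar R} {D : 'M[R]_c} :
  (m%:E < L)%E -> classS m L f -> 1%:M - m *: D \in unitmx ->
  negdef (Sym ((- sigma m L)%:M + D *m invmx (1%:M - m *: D))) ->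
  globally_continuous (loop_op (subdiff m f) D).
Proof.
move=> mL fS Du neg; set V := invmx _ in neg.
pose g x := (f x - (m * qf x)%:E)%E.
have pg : pcc g by case: fS.
pose M := (sigma m L)%:M - D *m V.
have Mneg x : x != 0 -> 0 < dot x (M *m x).
  move=> /neg; rewrite dot_Sym (_ : _ + _ = - M); last by rewrite opprB raddfN addrC.
  by rewrite mulNmx dotNr oppr_lt0.
have [eps [Meps /(_ Mneg) eps0]] := quadratic_lower_bound M.
have sig0 : 0 <= sigma m L.
  case: L mL {fS neg M Mneg Meps} => [l| |//].
    by rewrite lte_fin => ml; rewrite /sigma -EFinB inver subr_eq0 gt_eqF//= invr_ge0 subr_ge0 ltW.
  by rewrite /sigma addye// invey.
have [h hc hP] := monotone_feedback (convex_subdiff g) _ _ _ sig0 eps0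
  (fun u p v q => classS_cocoercive fS mL) (fun mu z => prox_exists mu z pg) Meps.
have {}hP x p : convex_subdiff g (x + D *m V *m p) p <-> p = h x.
  rewrite -hP; suff -> : x + D *m V *m p = x + sigma m L *: p - M *m p by [].
  by rewrite /M mulmxBl mul_scalar_mx opprB [_ - _ *: p]addrC addrA addrK.
have VK : V *m (1%:M - m *: D) = 1%:M by rewrite mulVmx.
have KV : (1%:M - m *: D) *m V = 1%:M by rewrite mulmxV.
(* V commutes with D because its inverse does. *)
have VD : V *m D = D *m V.
  have DK : (1%:M - m *: D) *m D = D *m (1%:M - m *: D).
    by rewrite mulmxBl mulmxBr mul1mx mulmx1 -scalemxAl -scalemxAr.
  by rewrite -[D in LHS]mulmx1 -KV (mulmxA D) -DK !mulmxA VK mul1mx.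
pose H x := h (V *m x) + m *: (V *m x + D *m V *m h (V *m x)).
exists H; last first.
  have hVc : continuous (fun x => h (V *m x)).
    move=> x; apply: (@continuous_comp _ _ _ (mulmx V) h x); last exact: hc.
    exact: mulmx_continuous.
  have DhVc : continuous (fun x => D *m V *m h (V *m x)).
    move=> x; apply: (@continuous_comp _ _ _ _ (mulmx (D *m V)) x (hVc x)).
    exact: mulmx_continuous.
  move=> x; have FFx := nbhs_filter x.
  apply: cvgD; first exact: hVc.
  apply: cvgZl_tmp; apply: cvgD; [exact: mulmx_continuous | exact: DhVc].
move=> x; apply/seteqP; split=> y /=.
  move=> /loop_opE[p]; set u := x + D *m y => pu yE.
  have uE : u = V *m x + D *m V *m p.
    rewrite -VD -mulmxA -mulmxDr -[LHS]mul1mx -VK -mulmxA; congr (_ *m _).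
    by rewrite mulmxBl mul1mx -scalemxAl {1}/u -yE mulmxDr -scalemxAr addrA addrK.
  have pE : p = h (V *m x) by apply/hP; rewrite -uE.
  by rewrite /H -pE -uE yE.
move=> ->; apply/loop_opE.
set p := h (V *m x); set u := V *m x + D *m V *m p.
have uE : x + D *m H x = u.
  rewrite /H -/p -/u.
  have : (1%:M - m *: D) *m u = x + D *m p.
    by rewrite /u mulmxDr (mulmxA _ V x) KV mul1mx -VD -(mulmxA V) (mulmxA _ V (D *m p)) KV mul1mx.
  rewrite mulmxBl mul1mx -scalemxAl => uE.
  by rewrite mulmxDr -scalemxAr addrA -uE subrK.
exists p; first by rewrite uE; apply/hP.
by rewrite uE.
Qed.

End Block.

(** * Block-triangular systems *)

Section Assembly.
Context {R : realType} {s c : nat}.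

Lemma mulmx_blocks {n} (B : 'M[R]_(n, bdim s c)) (w : 'cV[R]_(bdim s c)) :
  B *m w = \sum_(i < s) rblk B i *m cblk w i.
Proof. by rewrite -[B in LHS]submxrowK -[w in LHS]submxcolK mul_mxrow_mxcol. Qed.

Lemma cblkD (u v : 'cV[R]_(bdim s c)) i : cblk (u + v) i = cblk u i + cblk v i.
Proof. exact: submxcolD. Qed.

Lemma cblk_mul {n} (M : 'M[R]_(bdim s c, n)) (x : 'cV[R]_n) i :
  cblk (M *m x) i = cblk M i *m x.
Proof. by rewrite /cblk submxcol_mul. Qed.

Lemma cblk_lower_mul (D : 'M[R]_(bdim s c)) (w : 'cV[R]_(bdim s c)) i :
  (forall i j : 'I_s, (i < j)%N -> blk D i j = 0) ->
  cblk (D *m w) i =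
  \sum_(j < s | (j < i)%N) blk D i j *m cblk w j + blk D i i *m cblk w i.
Proof.
move=> D0; rewrite cblk_mul mulmx_blocks (bigD1 i)//= addrC.
congr (_ + _); last by rewrite /blk submxblockEv.
rewrite big_mkcond [RHS]big_mkcond; apply: eq_bigr => j _.
rewrite /rblk -submxblockEv -/(blk D i j) neq_ltn.
by case: ltngtP => //= ij; rewrite D0 // mul0mx.
Qed.

Lemma cblk_continuous i : continuous (fun u : 'cV[R]_(bdim s c) => cblk u i).
Proof.
move=> u; apply: mx_continuous_at => k j; rewrite mxE.
have -> : (fun y : 'cV[R]_(bdim s c) => cblk y i k j) = fun y => y (tagnat.Rank i k) j.
  by apply/funext => y; rewrite mxE.
exact: coord_continuous.
Qed.

(** Block i of the right-hand side depends on the blocks j < i of w only, so one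
    application of the update map G determines one further block, and its s-th
    iterate no longer depends on the starting point: it is the unique solution,
    and is continuous as a composite of continuous maps. *)
Lemma forward_substitution (hs : 'I_s -> 'cV[R]_c -> 'cV[R]_c) (D : 'M[R]_(bdim s c)) :
  (forall i, continuous (hs i)) ->
  exists2 h : 'cV[R]_(bdim s c) -> 'cV[R]_(bdim s c), continuous h &
    forall u w, w = h u <-> forall i,
      cblk w i = hs i (cblk u i + \sum_(j < s | (j < i)%N) blk D i j *m cblk w j).
Proof.
move=> hsc.
pose arg (u w : 'cV[R]_(bdim s c)) i := cblk u i + \sum_(j < s | (j < i)%N) blk D i j *m cblk w j.
pose G (u w : 'cV[R]_(bdim s c)) : 'cV[R]_(bdim s c) := mxcol (fun i => hs i (arg u w i)).
have GE u w i : cblk (G u w) i = hs i (arg u w i) by rewrite /cblk mxcolK.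
have fixP u w : w = G u w <-> forall i, cblk w i = hs i (arg u w i).
  split=> [{1}-> i|wE]; first exact: GE.
  by apply/mxcolP => i; rewrite -/(cblk w i) wE -GE.
have agree k u w w' (i : 'I_s) : (i < k)%N ->
    cblk (iter k (G u) w) i = cblk (iter k (G u) w') i.
  elim: k i => // k IH i ik; rewrite !iterS !GE; congr hs; congr (_ + _).
  by apply: eq_bigr => j ji; rewrite (IH j)// (leq_trans ji).
have iter_const u w w' : iter s (G u) w = iter s (G u) w'.
  by apply/mxcolP => i; exact: agree.
have Gc phi : continuous phi -> continuous (fun u => G u (phi u)).
  move=> phic u; apply: mx_continuous_at => k j; rewrite mxE.
  set i := tagnat.sig1 k; set l := tagnat.sig2 k.
  have -> : (fun y => G y (phi y) k j) = fun y => hs i (arg y (phi y) i) l j.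
    by apply/funext => y; rewrite mxE.
  have argc : continuous (fun u => arg u (phi u) i).
    have sumc : continuous (fun u => \sum_(j < s | (j < i)%N) blk D i j *m cblk (phi u) j).
      apply: continuous_sum => b v.
      apply: (@continuous_comp _ _ _ (fun v => cblk (phi v) b) (mulmx (blk D i b))).
        by apply: (@continuous_comp _ _ _ phi _ v (phic v)); exact: cblk_continuous.
      exact: mulmx_continuous.
    by move=> v; have FFv := nbhs_filter v; apply: cvgD; [exact: cblk_continuous | exact: sumc].
  have hargc : continuous (fun u => hs i (arg u (phi u) i)).
    by move=> v; apply: (@continuous_comp _ _ _ _ (hs i) v (argc v)); exact: hsc.
  apply: (@continuous_comp _ _ _ _ (fun M : 'cV[R]_c => M l j) u (hargc u)).
  exact: coord_continuous.
exists (fun u => iter s (G u) 0).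
  suff : forall k, continuous (fun u => iter k (G u) 0) by exact.
  by elim=> [|k IH]; [exact: cst_continuous | exact: Gc].
move=> u w; rewrite -fixP; split=> [->|wG].
  by rewrite -iterS iterSr; exact: iter_const.
by rewrite (iter_const u 0 w) iter_fix -?wG.
Qed.

End Assembly.

Theorem lemma3p2 (R : realType) (s c n : nat) (s_gt0 : (0 < s)%N)
    (c_gt0 : (0 < c)%N) (m : 'I_s -> R) (L : 'I_s -> \bar R)
    (m_lt_L : forall i, ((m i)%:E < L i)%E)
    (m_sum_gt0 : 0 < \sum_(i < s) m i)
    (f : 'I_s -> 'cV[R]_c -> \bar R)
    (F : 'cV[R]_(bdim s c) -> set 'cV[R]_(bdim s c))
    (F_classO : classO_with m L f F)
    (A : 'M[R]_n) (B : 'M[R]_(n, bdim s c)) (C : 'M[R]_(bdim s c, n))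
    (D : 'M[R]_(bdim s c))
    (D_lower : forall i j : 'I_s, (i < j)%N -> blk D i j = 0)
    (D_unit : forall i : 'I_s, 1%:M - m i *: blk D i i \in unitmx)
    (D_neg : forall i : 'I_s,
       negdef (Sym ((- sigma (m i) (L i))%:M
                    + blk D i i *m invmx (1%:M - m i *: blk D i i)))) :
  let H := loop_op F D in
  let Hs := fun i : 'I_s => loop_op (subdiff (m i) (f i)) (blk D i i) in
  [/\ globally_continuous H,
      forall i : 'I_s, single_valued (Hs i) &
      forall x0 : 'cV[R]_n,
        (exists! xw : (nat -> 'cV[R]_n) * (nat -> 'cV[R]_(bdim s c)),
           explicit_recursion A B C D Hs x0 xw.1 xw.2) /\
        (forall (x : nat -> 'cV[R]_n) (w : nat -> 'cV[R]_(bdim s c)),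
           implicit_recursion A B C H x0 x w <->
           explicit_recursion A B C D Hs x0 x w)].
Proof.
move=> H Hs; case: F_classO => fS FE _.
have /choice[hs hsP] i : exists h, (forall v, Hs i v = [set h v]) /\ continuous h.
  have [h hE hc] := loop_op_continuous (m_lt_L i) (fS i) (D_unit i) (D_neg i).
  by exists h.
have [h hc hP] := forward_substitution hs D (fun i => (hsP i).2).
have HsE i v y : Hs i v y <-> y = hs i v by rewrite (hsP i).1.
have HE u : H u = [set h u].
  apply/seteqP; split=> w /=.
    move=> /loop_opE; rewrite FE => Fw; apply/hP => i; apply/HsE/loop_opE.
    by have := Fw i; rewrite cblkD cblk_lower_mul// addrA.
  move=> /hP wE; apply/loop_opE; rewrite FE => i.
  have /HsE/loop_opE := wE i.
  by rewrite cblkD cblk_lower_mul// addrA.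
have set1E (T : Type) (a b : T) : [set a] = [set b] <-> b = a.
  by split=> [ab|-> //]; have : [set a] b by rewrite ab.
have recE x0 x w : implicit_recursion A B C H x0 x w <->
    explicit_recursion A B C D Hs x0 x w.
  split=> -[x0E xw]; split=> // k; have [wE xE] := xw k; split.
  - move: wE; rewrite HE => /set1E/hP wE i.
    by rewrite (hsP i).1; apply/set1E; rewrite wE cblk_mul.
  - by rewrite -mulmx_blocks.
  - rewrite HE; apply/set1E/hP => i; have := wE i.
    by rewrite (hsP i).1 => /set1E ->; rewrite cblk_mul.
  - by rewrite mulmx_blocks.
split; [by exists h | by move=> i v; exists (hs i v); exact: (hsP i).1 |].
move=> x0; split=> //.
pose x k := iter k (fun y => A *m y + B *m h (C *m y)) x0.
exists (x, fun k => h (C *m x k)); split=> [|[x' w'] /= /recE[x'0 x'S]].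
  by apply/recE; split=> // k; rewrite HE.
have w'E k : w' k = h (C *m x' k) by apply/set1E; rewrite -HE; case: (x'S k).
have x'E : x' = x.
  apply/funext; elim=> [|k IH]; first exact: x'0.
  by rewrite (x'S k).2 w'E IH.
by congr pair; [|apply/funext => k; rewrite w'E x'E].
Qed.
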